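(* Let $K$ be a field, let $I\subset S=K[x_1,\ldots,x_n]$ be a nonzero proper monomial ideal, and let $\bar S=S[y_1]$ with $y_1$ a new variable. Let $(I,y_1)\subset\bar S$ be the ideal generated by $I$ and $y_1$. If $\operatorname{sdepth}_{\bar S}((I,y_1))=\operatorname{sdepth}_S(I)$, then $\operatorname{sdepth}_S(I)\ge\operatorname{sdepth}_S(S/I)+1$.
   Context: Let $R$ be a polynomial ring over a field $K$ in finitely many variables $X$, with its multigrading by exponent vectors, and let $M\neq 0$ be a finitely generated multigraded $R$-module (for instance a quotient of monomial ideals). A Stanley decomposition of $M$ is a finite direct sum decomposition of $K$-vector spaces $\mathcal D: M=\bigoplus_{i=1}^t m_iK[Z_i]$, where the $m_i\in M$ are homogeneous, $Z_i\subset X$, and each $m_iK[Z_i]$ is a free $K[Z_i]$-module. Put $\operatorname{sdepth}(\mathcal D)=\min_i|Z_i|$, and let $\operatorname{sdepth}_R(M)$ be the maximum of $\operatorname{sdepth}(\mathcal D)$ over all Stanley decompositions of $M$. *)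

(* Defs.v *)
(* MathComp; boolp provides classical logic. *)
From HB Require Import structures.
From mathcomp Require Import all_boot all_order all_algebra.
From mathcomp Require Import generic_quotient ring_quotient.
From mathcomp Require Import boolp mpoly.

Set Implicit Arguments.
Unset Strict Implicit.
Unset Printing Implicit Defensive.

Import GRing.Theory.
Local Open Scope ring_scope.
Local Open Scope quotient_scope.

Section Submodule.
Variables (R : nzRingType) (V : lmodType R) (W : submodClosed V).

Record submod_of := Submod { submod_val : V; submod_valP : submod_val \in W }.

HB.instance Definition _ := [isSub for submod_val].
HB.instance Definition _ := [Choice of submod_of by <:].
HB.instance Definition _ := [SubChoice_isSubLmodule of submod_of by <:].

End Submodule.

Section QuotientModule.
Variables (R : nzRingType) (V : lmodType R) (W : submodClosed V).

Definition quotmod_pred : {pred V} := mem W.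

Fact quotmod_pred_zmod_closed : zmod_closed quotmod_pred.
Proof.
split=> [|u v Wu Wv]; first exact: (rpred0 W).
rewrite -scaleN1r; apply: (@rpredD _ W) => //.
exact: (@rpredZ _ _ W).
Qed.
HB.instance Definition _ :=
  GRing.isZmodClosed.Build V quotmod_pred quotmod_pred_zmod_closed.

(* The library's quotient of V by W is only an additive group. *)
Definition quotmod := Quotient.quot quotmod_pred.
HB.instance Definition _ := GRing.Zmodule.on quotmod.

Definition quotmod_pi (v : V) : quotmod := \pi_(Quotient.quot quotmod_pred) v.

Definition quotmod_scale (a : R) (q : quotmod) : quotmod :=
  quotmod_pi (a *: repr (q : Quotient.quot quotmod_pred)).

Lemma quotmod_piP (u v : V) : quotmod_pi u = quotmod_pi v <-> u - v \in W.
Proof.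
rewrite -[u - v \in W]/(u - v \in quotmod_pred) Quotient.idealrBE.
by split=> /eqP.
Qed.

Lemma quotmod_piD (u v : V) :
  quotmod_pi (u + v) = quotmod_pi u + quotmod_pi v.
Proof. by rewrite /quotmod_pi !piE. Qed.

Lemma quotmod_piZ (a : R) (v : V) :
  quotmod_pi (a *: v) = quotmod_scale a (quotmod_pi v).
Proof.
apply/quotmod_piP; rewrite -scalerBr; apply: (@rpredZ _ _ W).
by apply/quotmod_piP; rewrite /quotmod_pi reprK.
Qed.

Lemma quotmod_pi_surj (q : quotmod) : exists v, q = quotmod_pi v.
Proof. by exists (repr (q : Quotient.quot quotmod_pred)); rewrite /quotmod_pi reprK. Qed.

Fact quotmod_scaleA a b q :
  quotmod_scale a (quotmod_scale b q) = quotmod_scale (a * b) q.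
Proof. by have [v ->] := quotmod_pi_surj q; rewrite -!quotmod_piZ scalerA. Qed.

Fact quotmod_scale1 : left_id 1 quotmod_scale.
Proof.
by move=> q; have [v ->] := quotmod_pi_surj q; rewrite -quotmod_piZ scale1r.
Qed.

Fact quotmod_scaleDr : right_distributive quotmod_scale +%R.
Proof.
move=> a p q; have [u ->] := quotmod_pi_surj p.
have [v ->] := quotmod_pi_surj q.
by rewrite -quotmod_piD -!quotmod_piZ scalerDr quotmod_piD.
Qed.

Fact quotmod_scaleDl q : {morph quotmod_scale^~ q : a b / a + b}.
Proof.
move=> a b; have [v ->] := quotmod_pi_surj q.
by rewrite -!quotmod_piZ scalerDl quotmod_piD.
Qed.

HB.instance Definition _ := GRing.Zmodule_isLmodule.Build R quotmod
  quotmod_scaleA quotmod_scale1 quotmod_scaleDr quotmod_scaleDl.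

End QuotientModule.

(* A (possibly improper) ideal of a commutative ring R is a submodule of R seen as
   a module over itself. *)
Notation ideal R := (submodClosed R^o).

Section GeneratedIdeal.
Variables (R : comNzRingType) (A : R -> Prop).

Definition ideal_gen : {pred R^o} := fun f : R =>
  `[< exists s : seq (R * R),
        (forall c, c \in s -> A c.2) /\ f = \sum_(c <- s) c.1 * c.2 >].

Lemma ideal_gen_submod_closed : submod_closed ideal_gen.
Proof.
split; first by apply/asboolP; exists [::]; rewrite big_nil.
move=> a u v /asboolP[s [sA ->]] /asboolP[t [tA ->]]; apply/asboolP.
exists ([seq (a * c.1, c.2) | c <- s] ++ t); split=> [c|].
  by rewrite mem_cat => /orP[/mapP[d /sA Ad ->]|/tA].
rewrite big_cat big_map /=; congr (_ + _).
by rewrite [LHS]mulr_sumr; apply: eq_bigr => c _; rewrite mulrA.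
Qed.

HB.instance Definition _ :=
  GRing.isSubmodClosed.Build R R^o ideal_gen
    (GRing.submod_closed_semi ideal_gen_submod_closed).

End GeneratedIdeal.

Section StanleyDepth.
Variables (K : fieldType) (n : nat).
Local Notation S := {mpoly K[n]}.

(* K[Z], as a subset of K[x_1, ..., x_n] *)
Definition in_subring (Z : {set 'I_n}) (f : S) : Prop :=
  forall m, m \in msupp f -> forall i, m i != 0%N -> i \in Z.

Section Module.
(* The multigrading of M enters Stanley decompositions only through the
   predicate [homogeneous] of its homogeneous elements. *)
Variables (M : lmodType S) (homogeneous : M -> Prop).

(* m K[Z], as a subset of M *)
Definition in_stanley_space (m : M) (Z : {set 'I_n}) (w : M) : Prop :=
  exists2 f : S, in_subring Z f & w = f *: m.

Record stanley_decomp := StanleyDecomp {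
  sd_size : nat;
  sd_elt : 'I_sd_size -> M;
  sd_vars : 'I_sd_size -> {set 'I_n};
  sd_homog : forall i, homogeneous (sd_elt i);
  sd_free : forall i (f : S),
    in_subring (sd_vars i) f -> f *: sd_elt i = 0 -> f = 0;
  sd_direct : forall u : M, exists! w : {ffun 'I_sd_size -> M},
    (forall i, in_stanley_space (sd_elt i) (sd_vars i) (w i)) /\
    u = \sum_i w i }.

(* The default value n is neutral since #|Z_i| <= n; the family is nonempty
   as soon as M != 0. *)
Definition sdepth_decomp (D : stanley_decomp) : nat :=
  \big[minn/n]_(i < sd_size D) #|sd_vars i|.

Definition sdepth : nat :=
  \max_(d < n.+1 | `[< exists D, sdepth_decomp D = d >]) d.

End Module.

Definition mhomog (f : S) : Prop := exists (c : K) (m : 'X_{1..n}), f = c *: 'X_[m].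

(* sdepth_S(I) *)
Definition sdepth_ideal (I : ideal S) : nat :=
  @sdepth (submod_of I) (fun u => mhomog (submod_val u)).

(* sdepth_S(S/I); the homogeneous elements of S/I are the classes of the
   homogeneous elements of S. *)
Definition sdepth_quot (I : ideal S) : nat :=
  @sdepth (quotmod I) (fun q => exists2 f : S, mhomog f & q = quotmod_pi I f).

Definition monomial_ideal (I : ideal S) : Prop :=
  exists A : 'X_{1..n} -> Prop,
    I =i ideal_gen (fun f : S => exists2 m, A m & f = 'X_[m]).

(* (I, y_1) in S[y_1] = {mpoly K[n.+1]}, where y_1 is the last variable and
   mwiden is the inclusion of S in S[y_1] *)
Definition ideal_adjoin_var (I : ideal S) : ideal {mpoly K[n.+1]} :=
  ideal_gen (fun f : {mpoly K[n.+1]} =>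
    (exists2 g : S, g \in I & f = mwiden g) \/ f = 'X_ord_max).

End StanleyDepth.

(* Main.v *)
Require Import Defs.
From HB Require Import structures.
From mathcomp Require Import all_boot all_order all_algebra.
From mathcomp Require Import boolp mpoly.
Local Open Scope ring_scope.

Set Implicit Arguments.
Unset Strict Implicit.
Unset Printing Implicit Defensive.
Import GRing.Theory.

(** As a vector space, (I, y) is the direct sum of I[y] and y (S/I)[y]. Stanley
    decompositions of I and of S/I therefore combine into one of (I, y) in which
    every summand has gained the variable y, so that
      sdepth (I, y) >= min (sdepth I, sdepth (S/I)) + 1
    ([sdepth_ideal_adjoin_var]). If sdepth (I, y) = sdepth I, the minimum cannot
    be sdepth I, hence it is sdepth (S/I) < sdepth I.

    The combination is carried out on exponents. For a module with a monomial
    basis indexed by a set P of exponents, Stanley decompositions amount to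
    partitions of P into finitely many cones u + N^Z
    ([stanley_decomp_partition], [partition_stanley_decomp]); ideals spanned by
    monomials and their quotients are such modules ([ideal_basis],
    [quot_basis]), and the partitions of the exponents of I and of their
    complement give one for (I, y) ([stanley_partition_adjoin]).

    That I and S/I have decompositions at all, so that the maximum defining sdepth
    is attained, is Dickson's lemma: membership of m in a monomial ideal depends
    only on the truncation of m at some bound N ([upset_trunc]), and the fibres of
    the truncation are cones ([trunc_stanley_partition]). *)

(** * Cones and partitions of sets of exponents *)

Section Cones.
Variable n : nat.
Implicit Types (m u v : 'X_{1..n}) (Z : {set 'I_n}) (P : pred 'X_{1..n}).

Definition monomials_in Z v := forall i, v i != 0%N -> i \in Z.

(** The exponents of the monomials of x^u K[Z], for p = (u, Z). *)
Definition cone (p : 'X_{1..n} * {set 'I_n}) m : bool :=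
  [forall i, if i \in p.2 then (p.1 i <= m i)%N else m i == p.1 i].

Lemma coneP u Z m :
  reflect (exists2 v, monomials_in Z v & m = (v + u)%MM) (cone (u, Z) m).
Proof.
apply: (iffP forallP) => [h|[v Zv -> i] /=]; last first.
  rewrite mnmDE; case: ifP => [_|/negbT iZ]; first exact: leq_addl.
  by case: (eqVneq (v i) 0%N) => [->//|/Zv]; rewrite (negPf iZ).
exists (m - u)%MM => [i|].
  move: (h i); rewrite /= mnmBE; case: ifP => // _ /eqP ->.
  by rewrite subnn.
rewrite submK //; apply/mnm_lepP => i; move: (h i) => /=.
by case: ifP => // _ /eqP ->.
Qed.

(** The exponents satisfying P are the disjoint union of the cones listed in s:
    the booleans on both sides count 1 inside P and 0 outside, so one equation
    says that the cones stay inside P, cover P and do not overlap. *)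
Definition stanley_partition P (s : seq ('X_{1..n} * {set 'I_n})) :=
  forall m, count (cone^~ m) s = P m.

Definition upset P := forall m m', (m <= m')%MM -> P m -> P m'.

(** Each next index is chosen where s is minimal on the remaining tail. *)
Lemma nondecreasing_subsequence (s : nat -> nat) :
  exists2 g : nat -> nat, {homo g : a b / (a < b)%N} &
                          {homo s \o g : a b / (a <= b)%N}.
Proof.
have argmin k : exists j, (k <= j)%N /\ forall i, (k <= i)%N -> (s j <= s i)%N.
  (* Descent on a bound N for a value attained on the tail. *)
  suff: forall N j, (k <= j)%N -> (s j <= N)%N ->
      exists j, (k <= j)%N /\ forall i, (k <= i)%N -> (s j <= s i)%N.
    by move/(_ (s k) k (leqnn k) (leqnn _)).
  elim=> [|N IH] j kj sj.
    by exists j; split=> // i _; move: sj; rewrite leqn0 => /eqP->.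
  case: (pselect (exists2 i, (k <= i)%N & (s i < s j)%N)) => [[i ki ij]|no].
    by apply: (IH i ki); rewrite -ltnS (leq_trans ij).
  exists j; split=> // i ki; rewrite leqNgt; apply/negP => ij.
  by apply: no; exists i.
have [f fP] := choice argmin.
pose g := fix g k := if k is k'.+1 then f (g k').+1 else f 0%N.
have gP k : exists2 a, (a <= g k)%N & forall i, (a <= i)%N -> (s (g k) <= s i)%N.
  case: k => [|k] /=; [exists 0%N|exists (g k).+1] => //.
  - exact: (fP 0%N).2.
  - exact: (fP (g k).+1).1.
  - exact: (fP (g k).+1).2.
have gS k : (g k < g k.+1)%N by have [] := fP (g k).+1.
exists g; first exact: homo_ltn ltn_trans gS.
apply: homo_leq => [//|b a c|k]; first exact: leq_trans.
by have [a ag /= h] := gP k; apply: h; rewrite (leq_trans ag) // ltnW.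
Qed.

(** Dickson's lemma: extract successively for each coordinate, which preserves
    the monotonicity already obtained for the earlier ones. *)
Lemma nondecreasing_monomial_subsequence (s : nat -> 'X_{1..n}) :
  exists2 g : nat -> nat, {homo g : a b / (a < b)%N} &
    forall i, {homo (fun k => s (g k) i) : a b / (a <= b)%N}.
Proof.
suff [g g1 g2] : exists2 g : nat -> nat, {homo g : a b / (a < b)%N} &
    forall i, i \in enum 'I_n -> {homo (fun k => s (g k) i) : a b / (a <= b)%N}.
  by exists g => // i; apply: g2; rewrite mem_enum.
elim: (enum 'I_n) => [|i r [g g1 g2]]; first by exists id.
have [h h1 h2] := nondecreasing_subsequence (fun k => s (g k) i).
exists (g \o h) => [a b ab|j]; first by apply: g1; apply: h1.
rewrite inE => /predU1P[->//|/g2 gj a b ab]; apply: gj.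
by apply: (ltnW_homo h1).
Qed.

Definition mnm_trunc N m := [multinom minn (m i) N | i < n].

(** This is finite generation of monomial ideals in another form. If it
    failed, some s N would lie in P with its truncation at N outside, for
    every N. Along a nondecreasing subsequence s (g k) dominates s (g 0), and
    for large k so does its truncation at g k, which therefore lies in P. *)
Lemma upset_trunc P : upset P -> exists N, forall m, P (mnm_trunc N m) = P m.
Proof.
move=> upP; apply: contrapT => noN.
have cex N : exists m, P m /\ ~~ P (mnm_trunc N m).
  apply: contrapT => no; apply: noN; exists N => m; apply/idP/idP.
    by apply: upP; apply/mnm_lepP => i; rewrite mnmE geq_minl.
  by move=> Pm; apply: contrapT => /negP nP; apply: no; exists m.
have [s sP] := choice cex.
have [g g1 g2] := nondecreasing_monomial_subsequence s.
pose k := mdeg (s (g 0%N)).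
have kg : (k <= g k)%N by elim: k => // k IH; apply: (leq_ltn_trans IH); apply: g1.
case: (sP (g k)) => _ /negP; apply; apply: upP (sP (g 0%N)).1.
apply/mnm_lepP => i; rewrite mnmE leq_min (g2 i 0%N) //= (leq_trans _ kg) //.
by rewrite /k mdegE (bigD1 i) //= leq_addr.
Qed.

(** The fibres of the truncation at N are cones: the one over b frees the
    coordinates at which b reaches N. The fibres over the points of P in the box
    with side N partition P. *)
Lemma trunc_stanley_partition P N :
  (forall m, P (mnm_trunc N m) = P m) -> exists s, stanley_partition P s.
Proof.
move=> PN.
pose box := [seq [multinom (f i : nat) | i < n] | f : {ffun 'I_n -> 'I_N.+1}].
exists [seq (b, [set i | b i == N]) | b : 'X_{1..n} <- box & P b] => m.
have box_uniq : uniq box.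
  rewrite map_inj_uniq ?enum_uniq // => f g /mnmP fg.
  by apply/ffunP => i; apply: val_inj; have := fg i; rewrite !mnmE.
have box_trunc : mnm_trunc N m \in box.
  apply/mapP; exists [ffun i => inord (minn (m i) N)]; first by rewrite mem_enum.
  by apply/mnmP => i; rewrite !mnmE ffunE inordK // ltnS geq_minr.
have box_le b i : b \in box -> (b i <= N)%N.
  by case/mapP => f _ ->; rewrite mnmE -ltnS.
rewrite count_map count_filter.
rewrite (@eq_in_count _ _ (fun b => P m && (b == mnm_trunc N m))); last first.
  move=> b bb /=; rewrite /cone /=.
  rewrite -(PN m) andbC; case: (eqVneq b (mnm_trunc N m)) => [->|ne].
    rewrite !andbT [X in _ && X](_ : _ = true) ?andbT //; apply/forallP => i.
    rewrite inE mnmE; case: (leqP N (m i)) => mN; rewrite ?eqxx //.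
    by rewrite (ltn_eqF mN).
  rewrite andbF; apply: contraNF ne => /andP[_ /forallP h]; apply/eqP/mnmP => i.
  move: (h i); rewrite inE mnmE; case: eqP => [->|/eqP bN /eqP ->].
    by move=> /minn_idPr.
  by apply/esym/minn_idPl; apply: box_le.
case: (P m) => /=; last by rewrite count_pred0.
by rewrite count_uniq_mem // box_trunc.
Qed.

End Cones.

(** * Adjoining a variable to a partition *)

Section AdjoinVariable.
Variable n : nat.

Definition mnm_restrict (m : 'X_{1..n.+1}) : 'X_{1..n} :=
  [multinom m (widen_ord (leqnSn n) i) | i < n].

Definition mnm_extend (k : nat) (u : 'X_{1..n}) : 'X_{1..n.+1} :=
  (mnmwiden u + U_(ord_max) *+ k)%MM.

Definition adjoin_last (Z : {set 'I_n}) : {set 'I_n.+1} :=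
  ord_max |: [set widen_ord (leqnSn n) i | i in Z].

Lemma mnm_extend_widen k u (i : 'I_n) :
  mnm_extend k u (widen_ord (leqnSn n) i) = u i.
Proof.
rewrite /mnm_extend mnmDE mulmnE mnm1E mnmwiden_widen.
rewrite (_ : (_ == _ :> 'I_n.+1) = false) ?addn0 //.
by rewrite -val_eqE /= gtn_eqF.
Qed.

Lemma mnm_extend_max k u : mnm_extend k u ord_max = k.
Proof.
rewrite /mnm_extend mnmDE mulmnE mnm1E mnmwiden_ordmax eqxx add0n.
exact: mul1n.
Qed.

Lemma mnm_extend_restrict (m : 'X_{1..n.+1}) :
  mnm_extend (m ord_max) (mnm_restrict m) = m.
Proof.
apply/mnmP => i; case: (unliftP ord_max i) => [j|] ->; last first.
  exact: mnm_extend_max.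
rewrite (_ : lift ord_max j = widen_ord (leqnSn n) j).
  by rewrite mnm_extend_widen mnmE.
by apply: val_inj; exact: lift_max.
Qed.

Lemma widen_ordS_inj : injective (widen_ord (leqnSn n)).
Proof. by move=> i j /(congr1 val) ij; apply: val_inj. Qed.

Lemma card_adjoin_last Z : #|adjoin_last Z| = #|Z|.+1.
Proof.
rewrite cardsU1 (card_imset _ widen_ordS_inj) [_ \notin _](_ : _ = true) //.
apply/imsetP => -[i _ /(congr1 val) /= eq_ni].
by have := ltn_ord i; rewrite -eq_ni ltnn.
Qed.

Lemma forall_ord_recr (Q : pred 'I_n.+1) :
  [forall i, Q i] = [forall i, Q (widen_ord (leqnSn n) i)] && Q ord_max.
Proof.
apply/forallP/andP => [h|[/forallP h1 h2] i]; first by split=> //; apply/forallP.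
case: (unliftP ord_max i) => [j|] -> //.
suff -> : lift ord_max j = widen_ord (leqnSn n) j by [].
by apply: val_inj; exact: lift_max.
Qed.

Lemma cone_adjoin_last k u Z m :
  cone (mnm_extend k u, adjoin_last Z) m =
  cone (u, Z) (mnm_restrict m) && (k <= m ord_max)%N.
Proof.
rewrite /cone forall_ord_recr /= mnm_extend_max setU11; congr (_ && _).
apply: eq_forallb => i; rewrite mnm_extend_widen mnmE !inE.
rewrite (mem_imset _ _ widen_ordS_inj) [_ == ord_max](_ : _ = false) //.
by rewrite -val_eqE /= ltn_eqF.
Qed.

(** The exponents of the ideal (I, y) split into those of I[y] and those of
    y (S/I)[y]: a monomial outside I needs a positive exponent of y. Each cone
    gains the variable y, from y^0 on in the first part and from y^1 on in the
    second. *)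
Lemma stanley_partition_adjoin (P : pred 'X_{1..n}) s t :
  stanley_partition P s -> stanley_partition (predC P) t ->
  stanley_partition (fun m => P (mnm_restrict m) || (0 < m ord_max)%N)
    ([seq (mnm_extend 0 p.1, adjoin_last p.2) | p <- s] ++
     [seq (mnm_extend 1 p.1, adjoin_last p.2) | p <- t]).
Proof.
move=> sP tP m; rewrite count_cat !count_map.
have cnt k r :
    count (preim (fun p : 'X_{1..n} * {set 'I_n} =>
             (mnm_extend k p.1, adjoin_last p.2)) (fun q => cone q m)) r =
    ((k <= m ord_max) * count (fun q => cone q (mnm_restrict m)) r)%N.
  rewrite (@eq_count _ _
    (fun p => (k <= m ord_max)%N && cone p (mnm_restrict m))).
    by case: (_ <= _)%N => /=; rewrite ?mul1n ?count_pred0.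
  by move=> [u Z] /=; rewrite cone_adjoin_last andbC.
rewrite !cnt sP tP /= mul1n.
by case: (P _); case: (0 < _)%N.
Qed.

End AdjoinVariable.

(** * Decompositions and partitions *)

Section MonomialBasis.
Variables (K : fieldType) (n : nat).
Local Notation S := {mpoly K[n]}.

(** The common shape of a monomial ideal and of its quotient: a K-basis indexed
    by the exponents in P, on which monomials act by translation as long as they
    start from P. The element attached to an exponent outside P is 0, so for a
    quotient a translation may leave P, while for an ideal it cannot. *)
Record monomial_basis (M : lmodType S) (hom : M -> Prop)
    (P : pred 'X_{1..n}) := MonomialBasis {
  mb_elt : 'X_{1..n} -> M;
  mb_coef : 'X_{1..n} -> M -> K;
  mb_coef_linear : forall m c w w',
    mb_coef m (c%:MP *: w + w') = c * mb_coef m w + mb_coef m w';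
  mb_coef_elt : forall m u, mb_coef m (mb_elt u) = ((u == m) && P m)%:R;
  mb_scaleX : forall v u, P u -> 'X_[v] *: mb_elt u = mb_elt (v + u)%MM;
  mb_expand : forall w, exists s : seq 'X_{1..n},
    w = \sum_(m <- s) (mb_coef m w)%:MP *: mb_elt m;
  mb_homog : forall w, hom w <-> exists c u, w = c%:MP *: mb_elt u }.

Variables (M : lmodType S) (hom : M -> Prop) (P : pred 'X_{1..n}).
Variable B : monomial_basis hom P.
Local Notation e := (mb_elt B).
Local Notation cf := (mb_coef B).

Lemma coef0 m : cf m 0 = 0.
Proof.
have := mb_coef_linear B m 1 0 0.
rewrite scaler0 addr0 mul1r -[LHS]addr0 => /addrI.
by move/esym.
Qed.

Lemma coefD m w w' : cf m (w + w') = cf m w + cf m w'.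
Proof. by have := mb_coef_linear B m 1 w w'; rewrite mpolyC1 scale1r mul1r. Qed.

Lemma coefZ m c w : cf m (c%:MP *: w) = c * cf m w.
Proof. by have := mb_coef_linear B m c w 0; rewrite !addr0 coef0 addr0. Qed.

Lemma coef_sum m (T : Type) (r : seq T) (Q : pred T) (F : T -> M) :
  cf m (\sum_(i <- r | Q i) F i) = \sum_(i <- r | Q i) cf m (F i).
Proof. exact: (big_morph _ (coefD m) (coef0 m)). Qed.

Lemma coef_eq0 w : (forall m, cf m w = 0) -> w = 0.
Proof.
move=> w0; have [s ->] := mb_expand B w.
by rewrite big1 // => m _; rewrite w0 mpolyC0 scale0r.
Qed.

Lemma coef_inj w w' : (forall m, cf m w = cf m w') -> w = w'.
Proof.
move=> ww'; apply/eqP; rewrite -subr_eq0; apply/eqP/coef_eq0 => m.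
by rewrite -scaleN1r -mpolyC1 -mpolyCN coefD coefZ ww' mulN1r subrr.
Qed.

Lemma elt_eq0 u : (e u == 0) = ~~ P u.
Proof.
apply/eqP/idP => [eu0|nPu].
  have := coef0 u; rewrite -eu0 mb_coef_elt eqxx /=.
  by case: (P u) => // /eqP; rewrite oner_eq0.
apply: coef_eq0 => m; rewrite mb_coef_elt.
by case: eqP => //= <-; rewrite (negPf nPu).
Qed.

Lemma scale_elt f u :
  P u -> f *: e u = \sum_(v <- msupp f) (f@_v)%:MP *: e (v + u)%MM.
Proof.
move=> Pu; rewrite {1}[f]mpolyE scaler_suml; apply: eq_bigr => v _.
by rewrite -mul_mpolyC -scalerA mb_scaleX.
Qed.

Lemma coef_scale_elt f u v :
  P u -> P (v + u)%MM -> cf (v + u)%MM (f *: e u) = f@_v.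
Proof.
move=> Pu Pvu; rewrite scale_elt // coef_sum.
rewrite (eq_bigr (fun v' => f@_v' * (v' == v)%:R)); last first.
  by move=> v' _; rewrite coefZ mb_coef_elt Pvu andbT eqm_add2r.
case: (boolP (v \in msupp f)) => [vf|nvf].
  rewrite (bigD1_seq v) //= eqxx mulr1 big1 ?addr0 // => v' /negPf ->.
  by rewrite mulr0.
rewrite big_seq big1 ?(memN_msupp_eq0 nvf) // => v' v'f.
by case: eqP nvf => [<-|]; rewrite ?v'f // mulr0.
Qed.

Lemma coef_stanley_space u Z m w : P u ->
  in_stanley_space (e u) Z w -> cf m w != 0 -> cone (u, Z) m.
Proof.
move=> Pu [f Zf ->]; rewrite scale_elt // coef_sum.
apply: contra_neqT => nm; rewrite big_seq big1 // => v vf.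
rewrite coefZ mb_coef_elt; case: eqP => [vum|]; last by rewrite mulr0.
by case/negP: nm; apply/coneP; exists v => //; apply: Zf.
Qed.

Lemma in_subringX (Z : {set 'I_n}) v :
  monomials_in Z v -> in_subring Z ('X_[v] : S).
Proof. by move=> Zv m; rewrite msuppX inE => /eqP ->. Qed.

Lemma sdepth_decomp_le (D : stanley_decomp hom) i :
  (sdepth_decomp D <= #|sd_vars (s := D) i|)%N.
Proof.
rewrite /sdepth_decomp; have := mem_index_enum i.
elim: (index_enum _) => // j r IH; rewrite inE big_cons geq_min.
by case/predU1P => [->|/IH ->]; rewrite ?leqnn ?orbT.
Qed.

(** A homogeneous generator is a nonzero multiple of a basis element e u, and
    freeness keeps its cone inside P. Comparing coefficients of e m shows that
    some cone contains m. If two of them did, e m would have two decompositions,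
    each with a single nonzero component. *)
Lemma stanley_decomp_partition (D : stanley_decomp hom) :
  exists2 s, stanley_partition P s &
    all (fun p : 'X_{1..n} * {set 'I_n} => (sdepth_decomp D <= #|p.2|)%N) s.
Proof.
have /choice[ca caP] : forall i, exists ca : K * 'X_{1..n},
    sd_elt (s := D) i = ca.1%:MP *: e ca.2.
  by move=> i; have /(mb_homog B)[c [a ->]] := sd_homog (s := D) i; exists (c, a).
have elt_neq0 v i : monomials_in (sd_vars (s := D) i) v ->
    'X_[v] *: sd_elt (s := D) i != 0.
  move=> Zv; apply: contra_neq (oner_neq0 K) => Xv0.
  rewrite -(mcoeff0 K v) -(sd_free (s := D) (in_subringX Zv) Xv0).
  by rewrite mcoeffX eqxx.
have c0 i : (ca i).1 != 0.
  apply: contraNneq (elt_neq0 0%MM i _) => [c0|j]; last by rewrite mnm0E.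
  by rewrite caP c0 mpolyC0 scale0r scaler0.
have Pu i : P (ca i).2.
  apply: contraNT (elt_neq0 0%MM i _) => [nP|j]; last by rewrite mnm0E.
  by rewrite caP (eqP (_ : e _ == 0)) ?elt_eq0 // !scaler0.
have eltZ v i : 'X_[v] *: sd_elt (s := D) i =
    (ca i).1%:MP *: e (v + (ca i).2)%MM.
  by rewrite caP scalerA mulrC -scalerA mb_scaleX.
have coneP_sub i m : cone ((ca i).2, sd_vars (s := D) i) m -> P m.
  case/coneP => v Zv ->; apply: contraNT (elt_neq0 v i Zv) => nP.
  by rewrite eltZ (eqP (_ : e _ == 0)) ?elt_eq0 // scaler0.
have space0 i : in_stanley_space (sd_elt (s := D) i) (sd_vars (s := D) i) 0.
  by exists 0 => [m|]; rewrite ?scale0r // msupp0.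
have spaceE i w : in_stanley_space (sd_elt (s := D) i) (sd_vars (s := D) i) w ->
    in_stanley_space (e (ca i).2) (sd_vars (s := D) i) w.
  case=> f Zf ->; exists ((ca i).1 *: f).
    by move=> m /msuppZ_le; apply: Zf.
  by rewrite caP scalerA -mul_mpolyC mulrC.
have space_cone i m : cone ((ca i).2, sd_vars (s := D) i) m ->
    in_stanley_space (sd_elt (s := D) i) (sd_vars (s := D) i) (e m).
  case/coneP => v Zv ->; exists ((ca i).1^-1 *: 'X_[v]).
    by move=> m' /msuppZ_le; apply: in_subringX Zv _.
  rewrite -mul_mpolyC -scalerA eltZ scalerA -mpolyCM mulVf //.
  by rewrite mpolyC1 scale1r.
exists [seq ((ca i).2, sd_vars (s := D) i) | i <- enum 'I_(sd_size D)]; last first.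
  apply/allP => _ /mapP[i _ ->] /=.
  exact: sdepth_decomp_le.
move=> m; rewrite count_map -size_filter.
rewrite (_ : size _ = #|[pred i | cone ((ca i).2, sd_vars (s := D) i) m]|);
  last by rewrite cardE enumT.
case: (boolP (P m)) => [Pm|nPm]; last first.
  apply: eq_card0 => i; rewrite inE; apply: contraNF nPm; exact: coneP_sub.
(* Covering: the coefficient of e m in one of the summands is nonzero. *)
have [w [[wD we] _]] := sd_direct D (e m).
have [i im] : exists i, cone ((ca i).2, sd_vars (s := D) i) m.
  apply: contrapT => no; have /eqP := mb_coef_elt B m m.
  rewrite eqxx Pm we coef_sum big1 ?(eq_sym 0) ?oner_eq0 // => i _.
  apply/eqP; apply: contrapT => /negP nz; apply: no; exists i.
  exact: coef_stanley_space (spaceE _ _ (wD i)) nz.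
rewrite -[RHS](card1 i); apply: eq_card => j; rewrite !inE.
apply/idP/eqP => [jm|->//].
(* Disjointness: e m decomposes with its only component at i, or at j. *)
pose single k : {ffun 'I_(sd_size D) -> M} :=
  [ffun l => if l == k then e m else 0].
have singleP k : cone ((ca k).2, sd_vars (s := D) k) m ->
    (forall l, in_stanley_space (sd_elt (s := D) l) (sd_vars (s := D) l)
       (single k l)) /\ e m = \sum_l single k l.
  move=> km; split=> [l|]; first by rewrite ffunE; case: eqP => [->|_]; auto.
  rewrite (bigD1 k) //= ffunE eqxx big1 ?addr0 // => l /negPf lk.
  by rewrite ffunE lk.
have [w' [_ w'u]] := sd_direct D (e m).
have := congr1 (fun f : {ffun _ -> M} => f j)
  (etrans (esym (w'u _ (singleP j jm))) (w'u _ (singleP i im))).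
rewrite !ffunE eqxx; case: eqP => // _ /eqP; by rewrite elt_eq0 Pm.
Qed.

(** The component of w in the summand of index i must be the part of w
    supported on the cone of index i; this gives existence and uniqueness. The
    bound d <= n covers the empty partition, whose decomposition has depth n. *)
Lemma partition_stanley_decomp s d : stanley_partition P s ->
  (d <= n)%N -> all (fun p : 'X_{1..n} * {set 'I_n} => (d <= #|p.2|)%N) s ->
  exists D : stanley_decomp hom, (d <= sdepth_decomp D)%N.
Proof.
move=> sP dn sd.
pose p (i : 'I_(size s)) := tnth (in_tuple s) i.
pose C i := cone (p i).
have sumC m : (\sum_i C i m)%N = P m.
  rewrite -sP -sum1_count [RHS]big_tnth [RHS]big_mkcond /=.
  by apply: eq_bigr => i _; rewrite /C /p; case: (cone _ _).
have CP i m : C i m -> P m.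
  by rewrite -[P m]lt0b -sumC => im; rewrite (bigD1 i) //= im.
have CPu i : P (p i).1.
  by apply: (CP i); rewrite /C; case: (p i) => u Z; apply/coneP; exists 0%MM;
     [move=> j; rewrite mnm0E | rewrite add0m].
have C_uniq i j m : C i m -> C j m -> i = j.
  move=> im jm; apply/eqP; apply: contraT => ij.
  have := sumC m; rewrite (bigD1 i) //= (bigD1 j) 1?eq_sym //= im jm.
  by case: (P m).
have C_add i v : monomials_in (p i).2 v -> C i (v + (p i).1)%MM.
  by rewrite /C; case: (p i) => u Z /= Zv; apply/coneP; exists v.
have elt_hom i : hom (e (p i).1).
  by apply/(mb_homog B); exists 1, (p i).1; rewrite mpolyC1 scale1r.
have elt_free i (f : S) : in_subring (p i).2 f -> f *: e (p i).1 = 0 -> f = 0.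
  move=> Zf f0; apply/mpolyP => v; rewrite mcoeff0.
  case: (boolP (v \in msupp f)) => [vf|/memN_msupp_eq0 //].
  by rewrite -(coef_scale_elt f (CPu i) (CP i _ (C_add i v (Zf v vf)))) f0 coef0.
have direct w : exists! ws : {ffun 'I_(size s) -> M},
    (forall i, in_stanley_space (e (p i).1) (p i).2 (ws i)) /\ w = \sum_i ws i.
  have coefE (ws : {ffun 'I_(size s) -> M}) :
      (forall i, in_stanley_space (e (p i).1) (p i).2 (ws i)) /\
      w = \sum_i ws i ->
      forall i m, cf m (ws i) = if C i m then cf m w else 0.
    have out (ws' : {ffun 'I_(size s) -> M}) i m :
        in_stanley_space (e (p i).1) (p i).2 (ws' i) -> ~~ C i m ->
        cf m (ws' i) = 0.
      move=> wi; apply: contraNeq => /(coef_stanley_space (CPu i) wi).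
      by rewrite /C; case: (p i).
    case=> wsP wE i m; case: ifP => im; last by rewrite out ?im.
    rewrite wE coef_sum (bigD1 i) //= big1 ?addr0 // => j ji.
    rewrite out //; apply: contraNN ji => jm.
    by rewrite (C_uniq _ _ _ jm im).
  have [t tE] := mb_expand B w.
  pose ws := [ffun i => \sum_(m <- t | C i m) (cf m w)%:MP *: e m].
  have wsP : (forall i, in_stanley_space (e (p i).1) (p i).2 (ws i)) /\
      w = \sum_i ws i.
    split.
    - move=> i; exists (\sum_(m <- t | C i m) cf m w *: 'X_[m - (p i).1]).
        move=> v; rewrite mcoeff_msupp => vf j vj; apply: contraNT vf => jZ.
        rewrite raddf_sum /= big1 // => m im; rewrite mcoeffZ mcoeffX.
        case: eqP => [vE|]; last by rewrite mulr0.
        move/forallP: im => /(_ j); rewrite (negPf jZ) => /eqP mj.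
        by move: vj; rewrite -vE mnmBE mj subnn.
      rewrite ffunE scaler_suml; apply: eq_bigr => m im.
      rewrite -mul_mpolyC -scalerA mb_scaleX // submK //; apply/mnm_lepP => j.
      by move/forallP: im => /(_ j); case: ifP => // _ /eqP ->.
    - under [RHS]eq_bigr => i _ do rewrite ffunE big_mkcond.
      rewrite exchange_big {1}tE /=; apply: eq_bigr => m _.
      case: (boolP (P m)) => [Pm|]; last first.
        rewrite -elt_eq0 => /eqP ->; rewrite scaler0 big1 // => i _.
        by case: ifP.
      have [i im] : exists i, C i m.
        apply/existsP; apply: contraT => /existsPn no.
        by have := sumC m; rewrite Pm big1 // => i _; rewrite (negPf (no i)).
      rewrite (bigD1 i) //= im big1 ?addr0 // => j ji.
      by case: ifP => // jm; rewrite (C_uniq _ _ _ jm im) eqxx in ji.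
  exists ws; split=> // ws' ws'P; apply/ffunP => i; apply: coef_inj => m.
  by rewrite (coefE _ wsP) (coefE _ ws'P).
exists (StanleyDecomp elt_hom elt_free direct).
rewrite /sdepth_decomp; elim/big_ind: _ => //= [x y dx dy|i _].
  by rewrite leq_min dx.
by apply: (allP sd); apply: mem_tnth.
Qed.

End MonomialBasis.

Section DepthOfPartitions.
Variables (K : fieldType) (n : nat) (M : lmodType {mpoly K[n]}).
Variables (hom : M -> Prop) (P : pred 'X_{1..n}).
Variable B : monomial_basis hom P.

(** The initial partition is needed because the maximum defining sdepth is 0
    when there is no decomposition at all. *)
Lemma sdepth_partition : (exists s, stanley_partition P s) ->
  exists2 s, stanley_partition P s &
    all (fun p : 'X_{1..n} * {set 'I_n} => (sdepth hom <= #|p.2|)%N) s.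
Proof.
move=> [s0 s0P]; rewrite /sdepth; elim/big_ind: _ => [|x y|].
- by exists s0 => //; apply/allP.
- by rewrite /maxn; case: ifP.
by move=> d /asboolP[D <-]; apply: (stanley_decomp_partition B).
Qed.

Lemma partition_sdepth s d : stanley_partition P s -> (d <= n)%N ->
  all (fun p : 'X_{1..n} * {set 'I_n} => (d <= #|p.2|)%N) s ->
  (d <= sdepth hom)%N.
Proof.
move=> sP dn sd; have [D dD] := partition_stanley_decomp B sP dn sd.
have Dn : (sdepth_decomp D < n.+1)%N.
  rewrite ltnS /sdepth_decomp; elim/big_ind: _ => // [x y xn _|i _].
    by rewrite geq_min xn.
  by rewrite -[leqRHS](card_ord n) max_card.
apply: leq_trans dD _.
by apply: (leq_bigmax_cond (Ordinal Dn)); apply/asboolP; exists D.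
Qed.

End DepthOfPartitions.

(** * Monomial ideals and their quotients *)

Section MonomialIdeals.
Variables (K : fieldType) (n : nat).
Local Notation S := {mpoly K[n]}.

Definition ideal_monomials (J : ideal S) : pred 'X_{1..n} :=
  fun m => 'X_[m] \in J.

Lemma ideal_mull (J : ideal S) (f g : S) : g \in J -> f * g \in J.
Proof. exact: (@rpredZ _ _ J). Qed.

Lemma ideal_monomials_upset (J : ideal S) : upset (ideal_monomials J).
Proof.
move=> m m' mm' mJ; rewrite /ideal_monomials -(submK mm') mpolyXD.
exact: ideal_mull.
Qed.

Lemma msupp_ideal_gen (A : S -> Prop) (Q : pred 'X_{1..n}) : upset Q ->
  (forall f, A f -> forall m, m \in msupp f -> Q m) ->
  forall f, f \in ideal_gen A -> forall m, m \in msupp f -> Q m.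
Proof.
move=> upQ AQ f /asboolP[s [sA ->]] m; rewrite mcoeff_msupp.
apply: contraNT => nQ; rewrite raddf_sum big_seq big1 //= => c cs.
apply/eqP; rewrite mcoeff_eq0; apply: contra nQ => /msuppM_le/allpairsP.
case=> -[m1 m2] /= [_ m2c ->]; apply: upQ (lem_addl _ _) _.
exact: AQ _ (sA c cs) m2 m2c.
Qed.

(** The form in which monomiality of an ideal is used: membership is tested
    coefficientwise. *)
Definition spanned_by_monomials (J : ideal S) :=
  forall f : S, f \in J -> forall m, m \in msupp f -> 'X_[m] \in J.

Lemma monomial_ideal_spanned (J : ideal S) :
  monomial_ideal J -> spanned_by_monomials J.
Proof.
case=> A JE f; rewrite JE; apply: (msupp_ideal_gen (@ideal_monomials_upset J)).
move=> _ [m Am ->] m'; rewrite msuppX inE => /eqP ->.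
rewrite /ideal_monomials JE; apply/asboolP; exists [:: (1, 'X_[m])].
split=> [c|]; last by rewrite big_seq1 mul1r.
by rewrite inE => /eqP ->; exists m.
Qed.

Section Bases.
Variables (J : ideal S) (J_spanned : spanned_by_monomials J).
Local Notation P := (ideal_monomials J).

(** Outside P the value is 0, the default of insubd. *)
Definition ideal_elt (m : 'X_{1..n}) : submod_of J := insubd 0 ('X_[m] : S^o).

Lemma ideal_eltE m : P m -> submod_val (ideal_elt m) = 'X_[m].
Proof. by move=> Pm; rewrite -[LHS]/(val _) insubdK. Qed.

Lemma ideal_elt0 m : ~~ P m -> ideal_elt m = 0.
Proof. by move=> nP; rewrite /ideal_elt /insubd insubN. Qed.

Fact ideal_coef_linear m (c : K) (w w' : submod_of J) :
  (submod_val (c%:MP *: w + w'))@_m = c * (submod_val w)@_m + (submod_val w')@_m.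
Proof. by rewrite -mcoeffCM -mcoeffD. Qed.

Fact ideal_coef_elt m u : (submod_val (ideal_elt u))@_m = ((u == m) && P m)%:R.
Proof.
case: (boolP (P u)) => [Pu|nPu].
  by rewrite ideal_eltE // mcoeffX; case: eqP => // <-; rewrite Pu.
rewrite ideal_elt0 // mcoeff0.
by case: eqP => //= <-; rewrite (negPf nPu).
Qed.

Fact ideal_scaleX v u : P u -> 'X_[v] *: ideal_elt u = ideal_elt (v + u)%MM.
Proof.
move=> Pu; apply: val_inj; rewrite /= !ideal_eltE ?mpolyXD //.
by apply: ideal_monomials_upset Pu; apply: lem_addl.
Qed.

Fact ideal_expand (w : submod_of J) : exists s : seq 'X_{1..n},
  w = \sum_(m <- s) ((submod_val w)@_m)%:MP *: ideal_elt m.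
Proof.
exists (msupp (submod_val w)); apply: val_inj.
rewrite [RHS]raddf_sum /= [LHS]mpolyE big_seq [RHS]big_seq; apply: eq_bigr => m mw.
rewrite -mul_mpolyC -ideal_eltE //.
exact: J_spanned _ (submod_valP w) m mw.
Qed.

Fact ideal_homog (w : submod_of J) : mhomog (submod_val w) <->
  exists c u, w = c%:MP *: ideal_elt u.
Proof.
split=> -[c [u]].
  case: (eqVneq c 0) => [->|c0] wE.
    by exists 0, 0%MM; apply: val_inj; rewrite /= wE mpolyC0 !scale0r.
  exists c, u; apply: val_inj; rewrite /= wE -mul_mpolyC -ideal_eltE //.
  apply: J_spanned _ (submod_valP w) _ _.
  by rewrite wE msuppMCX // inE.
case: (boolP (P u)) => [Pu ->|/ideal_elt0-> ->].
  exists c, u; rewrite -mul_mpolyC -ideal_eltE //.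
by exists 0, 0%MM; rewrite scaler0 scale0r.
Qed.

Definition ideal_basis :
    monomial_basis (fun w : submod_of J => mhomog (submod_val w)) P :=
  MonomialBasis ideal_coef_linear ideal_coef_elt ideal_scaleX ideal_expand
    ideal_homog.

Definition quot_elt (m : 'X_{1..n}) : quotmod J := quotmod_pi J 'X_[m].

(** Coefficients at monomials outside a monomial ideal depend only on the class
    modulo the ideal. *)
Definition quot_coef (m : 'X_{1..n}) (q : quotmod J) : K :=
  if P m then 0 else (repr (q : Quotient.quot (quotmod_pred J)))@_m.

Fact quot_coef_pi m (f : S) :
  quot_coef m (quotmod_pi J f) = if P m then 0 else f@_m.
Proof.
rewrite /quot_coef; case: ifP => // nP; apply/eqP; rewrite -subr_eq0 -mcoeffB.
rewrite mcoeff_eq0; apply: contraFN nP; apply: J_spanned.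
by apply/quotmod_piP; rewrite /quotmod_pi reprK.
Qed.

Fact quot_coef_linear m c q q' :
  quot_coef m (c%:MP *: q + q') = c * quot_coef m q + quot_coef m q'.
Proof.
have [f ->] := quotmod_pi_surj q; have [g ->] := quotmod_pi_surj q'.
rewrite -[_ *: _]quotmod_piZ -quotmod_piD !quot_coef_pi.
by case: ifP; rewrite ?mulr0 ?addr0 // mcoeffD mcoeffCM.
Qed.

Fact quot_coef_elt m u : quot_coef m (quot_elt u) = ((u == m) && predC P m)%:R.
Proof. by rewrite quot_coef_pi mcoeffX /=; case: (P m); rewrite ?andbF ?andbT. Qed.

Fact quot_scaleX v u :
  predC P u -> 'X_[v] *: quot_elt u = quot_elt (v + u)%MM.
Proof. by move=> _; rewrite -[LHS]quotmod_piZ /quot_elt mpolyXD. Qed.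

Fact quot_expand q : exists s : seq 'X_{1..n},
  q = \sum_(m <- s) (quot_coef m q)%:MP *: quot_elt m.
Proof.
have [f ->] := quotmod_pi_surj q; exists (msupp f).
have pi0 : quotmod_pi J 0 = 0.
  by apply: (addrI (quotmod_pi J 0)); rewrite -quotmod_piD !addr0.
rewrite {1}[f]mpolyE (big_morph _ (@quotmod_piD _ _ J) pi0).
apply: eq_bigr => m _; rewrite quot_coef_pi.
case: ifP => [Pm|_]; last by rewrite -[RHS]quotmod_piZ -mul_mpolyC.
rewrite mpolyC0 scale0r -pi0; apply/quotmod_piP; rewrite subr0 -mul_mpolyC.
exact: ideal_mull.
Qed.

Fact quot_homog (q : quotmod J) :
  (exists2 f : S, mhomog f & q = quotmod_pi J f) <->
  exists c u, q = c%:MP *: quot_elt u.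
Proof.
have piZ c u : quotmod_pi J (c *: 'X_[u] : S) = c%:MP *: quot_elt u.
  by rewrite -mul_mpolyC [LHS]quotmod_piZ.
split=> [[_ [c [u ->]] ->]|[c [u ->]]]; first by exists c, u; rewrite piZ.
by exists (c *: 'X_[u]); [exists c, u | rewrite piZ].
Qed.

Definition quot_basis : monomial_basis
    (fun q => exists2 f : S, mhomog f & q = quotmod_pi J f) (predC P) :=
  MonomialBasis quot_coef_linear quot_coef_elt quot_scaleX quot_expand
    quot_homog.

End Bases.
End MonomialIdeals.

(** * Monomials of (I, y) *)

Section AdjoinVariableToIdeal.
Variables (K : fieldType) (n : nat) (I : ideal {mpoly K[n]}).
Hypothesis I_spanned : spanned_by_monomials I.

Let Q (m : 'X_{1..n.+1}) :=
  ideal_monomials I (mnm_restrict m) || (0 < m ord_max)%N.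

(** Q is an upset containing the supports of the generators of (I, y). *)
Lemma ideal_adjoin_var_msupp (f : {mpoly K[n.+1]}) :
  f \in ideal_adjoin_var I -> forall m, m \in msupp f -> Q m.
Proof.
apply: msupp_ideal_gen => [m m' /mnm_lepP mm' /orP[mI|m0]|].
- apply/orP; left; apply: ideal_monomials_upset mI.
  by apply/mnm_lepP => i; rewrite !mnmE.
- by apply/orP; right; apply: leq_trans (mm' _).
move=> {}f [[g gI ->] m|-> m]; last first.
  by rewrite msuppX inE => /eqP ->; rewrite /Q mnm1E eqxx orbT.
rewrite [g]mpolyE raddf_sum mcoeff_msupp raddf_sum /=.
apply: contraNT => nQ; rewrite big_seq big1 // => u ug.
rewrite mwidenZ mwidenX mcoeffZ mcoeffX; case: eqP => [um|]; last by rewrite mulr0.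
case/negP: nQ; rewrite /Q -um (_ : mnm_restrict _ = u); last first.
  by apply/mnmP => i; rewrite mnmE mnmwiden_widen.
by rewrite (I_spanned gI ug : ideal_monomials I u).
Qed.

Lemma ideal_adjoin_var_monomials m :
  ideal_monomials (ideal_adjoin_var I) m = Q m.
Proof.
apply/idP/idP => [mJ|].
  by apply: (ideal_adjoin_var_msupp mJ); rewrite msuppX inE.
have genJ (f g : {mpoly K[n.+1]}) :
    (exists2 h : {mpoly K[n]}, h \in I & g = mwiden h) \/ g = 'X_ord_max ->
    f * g \in ideal_adjoin_var I.
  move=> gA; apply/asboolP; exists [:: (f, g)].
  split=> [c|]; last by rewrite big_seq1.
  by rewrite inE => /eqP ->.
case/orP => [mI|m0].
  rewrite /ideal_monomials -(mnm_extend_restrict m) /mnm_extend addmC mpolyXD.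
  by apply: genJ; left; exists 'X_[mnm_restrict m]; rewrite ?mwidenX.
have mU : (U_(ord_max) <= m)%MM.
  by apply/mnm_lepP => i; rewrite mnm1E; case: eqP => [<-|].
rewrite /ideal_monomials -(submK mU) mpolyXD.
by apply: genJ; right.
Qed.

Lemma ideal_adjoin_var_spanned : spanned_by_monomials (ideal_adjoin_var I).
Proof.
move=> f fJ m mf; have := ideal_adjoin_var_msupp fJ mf.
by rewrite -ideal_adjoin_var_monomials.
Qed.

End AdjoinVariableToIdeal.

(** * The depth inequality *)

(** Optimal partitions for I and for S/I combine into one for (I, y) whose cones
    all have one more free variable. *)
Lemma sdepth_ideal_adjoin_var (K : fieldType) n (I : ideal {mpoly K[n]}) :
  monomial_ideal I ->
  (minn (sdepth_ideal I) (sdepth_quot I) < sdepth_ideal (ideal_adjoin_var I))%N.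
Proof.
move=> /monomial_ideal_spanned I_sp.
have [N PN] := upset_trunc (@ideal_monomials_upset _ _ I).
have [s sP sd] := sdepth_partition (ideal_basis I_sp)
  (trunc_stanley_partition PN).
have [t tP td] := sdepth_partition (quot_basis I_sp)
  (trunc_stanley_partition (P := predC (ideal_monomials I))
     (fun m => congr1 negb (PN m))).
rewrite -/(sdepth_ideal I) in sd; rewrite -/(sdepth_quot I) in td.
have stP m := etrans (stanley_partition_adjoin sP tP m)
  (congr1 nat_of_bool (esym (ideal_adjoin_var_monomials I_sp m))).
apply: (partition_sdepth (ideal_basis (ideal_adjoin_var_spanned I_sp)) stP).
  rewrite ltnS geq_min /sdepth_ideal /sdepth; apply/orP; left.
  by apply/bigmax_leqP => i _; rewrite -ltnS.
rewrite all_cat !all_map; apply/andP; split; apply/allP => p ps /=.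
  by rewrite card_adjoin_last ltnS geq_min (allP sd p ps).
by rewrite card_adjoin_last ltnS geq_min (allP td p ps) orbT.
Qed.

Theorem mainTheorem2 (K : fieldType) (n : nat) (I : ideal {mpoly K[n]})
    (I_monomial : monomial_ideal I)
    (I_nonzero : exists2 f : {mpoly K[n]}, f \in I & f != 0)
    (I_proper : (1 : {mpoly K[n]}) \notin I) :
  sdepth_ideal (ideal_adjoin_var I) = sdepth_ideal I ->
  (sdepth_ideal I >= sdepth_quot I + 1)%N.
Proof.
move=> depth_eq; have := sdepth_ideal_adjoin_var I_monomial.
by rewrite depth_eq gtn_min ltnn addn1.
Qed.
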